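(* Let $P:\mathbb{C}^{op}\to\mathbf{ISL}$ be a primary doctrine, let $P_{\mathcal{D}}:\mathcal{Q}_P^{op}\to\mathbf{ISL}$ be its elementary doctrine of descent data, and let $\varepsilon_P=(\mathbb{U},i):P_{\mathcal{D}}\to P$ be the canonical 1-arrow. Then: (i) if $P$ has finite distributive joins, then so has $P_{\mathcal{D}}$, and $\varepsilon_P$ preserves them; (ii) if $P$ is implicational, then so is $P_{\mathcal{D}}$, and $\varepsilon_P$ preserves the relative pseudo-complements; (iii) if $P$ is existential, then so is $P_{\mathcal{D}}$, and $\varepsilon_P$ preserves the left adjoints along projections; (iv) if $P$ is universal, then so is $P_{\mathcal{D}}$, and $\varepsilon_P$ preserves the right adjoints along projections; (v) if $P$ has comprehensions (respectively, full comprehensions), then so has $P_{\mathcal{D}}$, and $\varepsilon_P$ preserves them.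
   Context: $\mathbf{ISL}$ is the category of inf-semilattices (posets with finite meets $\wedge$ and top $\top$) and homomorphisms. A primary doctrine is a functor $P:\mathbb{C}^{op}\to\mathbf{ISL}$ where $\mathbb{C}$ has binary products; $f^*$ denotes $P(f)$ (reindexing along $f$). Write $\mathrm{pr}_i$ for projections from products, $\Delta_A=\langle id_A,id_A\rangle$, and $\top_A$ for the top of $P(A)$. $P$ is elementary if for every $A$ there is $\delta_A\in P(A\times A)$ such that for every $X$: $\alpha\mapsto \mathrm{pr}_1^*(\alpha)\wedge\delta_A$ is left adjoint to $\Delta_A^*$, and $\alpha\mapsto\langle \mathrm{pr}_1,\mathrm{pr}_2\rangle^*(\alpha)\wedge\langle \mathrm{pr}_2,\mathrm{pr}_3\rangle^*(\delta_A)$ is left adjoint to $(id_X\times\Delta_A)^*$. An equivalence relation on $A$ is $\rho\in P(A\times A)$ with $\top_A\le\Delta_A^*\rho$; $\rho\le\langle \mathrm{pr}_2,\mathrm{pr}_1\rangle^*\rho$; and $\langle \mathrm{pr}_1,\mathrm{pr}_2\rangle^*\rho\wedge\langle \mathrm{pr}_2,\mathrm{pr}_3\rangle^*\rho\le\langle \mathrm{pr}_1,\mathrm{pr}_3\rangle^*\rho$ in $P(A\times A\times A)$. The category $\mathcal{Q}_P$ has as objects the pairs $(A,\rho)$ with $\rho$ an equivalence relation on $A$, as morphisms $(A,\rho)\to(B,\sigma)$ the arrows $f:A\to B$ of $\mathbb{C}$ with $\rho\le(f\times f)^*\sigma$, and composition as in $\mathbb{C}$; its binary products are $(A\times B,\rho\boxtimes\sigma)$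 with $\rho\boxtimes\sigma=\langle \mathrm{pr}_1,\mathrm{pr}_3\rangle^*\rho\wedge\langle \mathrm{pr}_2,\mathrm{pr}_4\rangle^*\sigma$. $\mathcal{D}es_\rho$ is the sub-poset of $P(A)$ of those $\alpha$ with $\mathrm{pr}_1^*\alpha\wedge\rho\le \mathrm{pr}_2^*\alpha$. $P_{\mathcal{D}}$ sends $(A,\rho)$ to $\mathcal{D}es_\rho$ and $f:(A,\rho)\to(B,\sigma)$ to the restriction $f^*:\mathcal{D}es_\sigma\to\mathcal{D}es_\rho$; it is elementary with $\delta_{(A,\rho)}=\rho$. The 1-arrow $\varepsilon_P$ consists of the forgetful functor $\mathbb{U}:\mathcal{Q}_P\to\mathbb{C}$, $(A,\rho)\mapsto A$, $f\mapsto f$, and the inclusions $i_{(A,\rho)}:\mathcal{D}es_\rho\hookrightarrow P(A)$. For a primary doctrine $P$: - $P$ has finite distributive joins if every fiber $P(A)$ has finite joins (including a bottom element) and $x\wedge(y\vee z)=(x\wedge y)\vee(x\wedge z)$ for all $x,y,z$ in a fiber. - $P$ is implicational if every fiber has relative pseudo-complements $x\Rightarrow y$ (i.e. $z\le x\Rightarrow y$ iff $z\wedge x\le y$) which commute with reindexing. - $P$ is universal if for every projection $\pi$ the functor $\pi^*$ has a right adjoint $\forall_\pi$ satisfying the Beck-Chevalley condition: for $f:Y'\to Y$ and projections $\pi:X\times Y\to Y$, $\pi':X\times Y'\to Y'$ one has $\forall_{\pi'}\circ(id_X\times f)^*=f^*\circ\forall_\pi$. - $P$ is existential if for every projection $\pi$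 the functor $\pi^*$ has a left adjoint $\exists_\pi$ satisfying the Beck-Chevalley condition ($\exists_{\pi'}\circ(id_X\times f)^*=f^*\circ\exists_\pi$ for the same squares) and Frobenius reciprocity: $\exists_\pi(\alpha\wedge\pi^*\beta)=\exists_\pi(\alpha)\wedge\beta$ for $\pi:X\times Y\to Y$, $\alpha\in P(X\times Y)$, $\beta\in P(Y)$. - A comprehension of $\phi\in P(A)$ is a morphism $\lfloor\phi\rfloor:X\to A$ terminal with respect to the property $\top_X\le\lfloor\phi\rfloor^*(\phi)$: that is, this property holds, and every $g:Y\to A$ with $\top_Y\le g^*(\phi)$ factors uniquely through $\lfloor\phi\rfloor$. $P$ has comprehensions if every $\phi$ in every fiber has one. A comprehension $\lfloor\phi\rfloor:X\to A$ is full if for all $\beta\in P(A)$, $\top_X\le\lfloor\phi\rfloor^*(\beta)$ implies $\phi\le\beta$; $P$ has full comprehensions if it has comprehensions and they are all full. That $\varepsilon_P$ preserves the logical operations means that in $\mathcal{D}es_\rho$ they are computed as in $P(A)$, i.e. the inclusions $i$ commute with them; that it preserves comprehensions means that $\mathbb{U}$ sends a comprehension of $\alpha\in P_{\mathcal{D}}(A,\rho)$ to a comprehension of $\alpha\in P(A)$.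
   Formalization: In (i), having finite distributive joins is taken to include that the bottom and the binary joins are preserved by reindexing, both for P and for the doctrine of descent data; with joins only in each fiber, (i) fails for subobjects of pointed sets. *)

(* Defs.v *)
From Stdlib Require Import Relations ProofIrrelevance.

Set Implicit Arguments.
Unset Strict Implicit.
Unset Printing Implicit Defensive.

Declare Scope doctrine_scope.
Delimit Scope doctrine_scope with D.
Local Open Scope doctrine_scope.

Record ISL : Type := {
  carrier :> Type;
  le : relation carrier;
  top : carrier;
  meet : carrier -> carrier -> carrier;
  le_order : order carrier le;
  le_top : forall x, le x top;
  le_meet : forall x y z, le z (meet x y) <-> le z x /\ le z y
}.
Arguments le {_}.
Arguments top {_}.
Arguments meet {_}.

Notation "x ≤ y" := (le x y) (at level 70, no associativity) : doctrine_scope.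
Notation "x ⊓ y" := (meet x y) (at level 40, left associativity) : doctrine_scope.
Notation "⊤" := top (at level 0) : doctrine_scope.

Lemma le_refl (L : ISL) (x : L) : x ≤ x.
Proof. apply (ord_refl _ _ (le_order L)). Qed.

Lemma le_trans (L : ISL) (x y z : L) : x ≤ y -> y ≤ z -> x ≤ z.
Proof. apply (ord_trans _ _ (le_order L)). Qed.

Lemma le_antisym (L : ISL) (x y : L) : x ≤ y -> y ≤ x -> x = y.
Proof. apply (ord_antisym _ _ (le_order L)). Qed.

Lemma meet_le_l (L : ISL) (x y : L) : x ⊓ y ≤ x.
Proof. apply (proj1 (le_meet x y _)), le_refl. Qed.

Lemma meet_le_r (L : ISL) (x y : L) : x ⊓ y ≤ y.
Proof. apply (proj1 (le_meet x y _)), le_refl. Qed.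

Lemma meet_glb (L : ISL) (x y z : L) : z ≤ x -> z ≤ y -> z ≤ x ⊓ y.
Proof. intros; apply le_meet; auto. Qed.

Lemma meet_mono (L : ISL) (x y x' y' : L) :
  x ≤ x' -> y ≤ y' -> x ⊓ y ≤ x' ⊓ y'.
Proof.
intros hx hy; apply meet_glb.
- exact (le_trans (meet_le_l x y) hx).
- exact (le_trans (meet_le_r x y) hy).
Qed.

Record ISLHom (L M : ISL) : Type := {
  isl_fun :> L -> M;
  isl_top : isl_fun ⊤ = ⊤;
  isl_meet : forall x y, isl_fun (x ⊓ y) = isl_fun x ⊓ isl_fun y
}.

Lemma isl_mono (L M : ISL) (f : ISLHom L M) (x y : L) : x ≤ y -> f x ≤ f y.
Proof.
intros h.
assert (e : x ⊓ y = x).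
{ apply le_antisym; [apply meet_le_l | apply meet_glb; [apply le_refl | exact h]]. }
rewrite <- e, isl_meet; apply meet_le_r.
Qed.

Definition is_bottom (L : ISL) (b : L) : Prop := forall x : L, b ≤ x.

Definition is_join (L : ISL) (x y j : L) : Prop :=
  forall z : L, j ≤ z <-> x ≤ z /\ y ≤ z.

Definition is_rpc (L : ISL) (x y r : L) : Prop :=
  forall z : L, z ≤ r <-> z ⊓ x ≤ y.

Definition left_adjoint (L M : ISL) (E : M -> L) (f : ISLHom L M) : Prop :=
  forall (a : M) (b : L), E a ≤ b <-> a ≤ f b.

Definition right_adjoint (L M : ISL) (G : M -> L) (f : ISLHom L M) : Prop :=
  forall (a : M) (b : L), f b ≤ a <-> b ≤ G a.

Record Category : Type := {
  ob :> Type;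
  hom : ob -> ob -> Type;
  idc : forall A, hom A A;
  comp : forall A B D, hom B D -> hom A B -> hom A D;
  comp_id_l : forall A B (f : hom A B), comp (idc B) f = f;
  comp_id_r : forall A B (f : hom A B), comp f (idc A) = f;
  comp_assoc : forall A B D E (h : hom D E) (g : hom B D) (f : hom A B),
    comp h (comp g f) = comp (comp h g) f
}.
Arguments hom {_}.
Arguments idc {_}.
Arguments comp {_ _ _ _}.

Notation "g ∘ f" := (comp g f) (at level 40, left associativity) : doctrine_scope.

Definition is_product (C : Category) (A B W : C) (p : hom W A) (q : hom W B) : Prop :=
  forall (X : C) (f : hom X A) (g : hom X B),
    exists! h : hom X W, p ∘ h = f /\ q ∘ h = g.

Record ProdCategory : Type := {
  pcat :> Category;
  prd : pcat -> pcat -> pcat;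
  pr1 : forall A B, hom (prd A B) A;
  pr2 : forall A B, hom (prd A B) B;
  pair : forall X A B, hom X A -> hom X B -> hom X (prd A B);
  pair_pr1 : forall X A B (f : hom X A) (g : hom X B), pr1 A B ∘ pair f g = f;
  pair_pr2 : forall X A B (f : hom X A) (g : hom X B), pr2 A B ∘ pair f g = g;
  pair_eta : forall X A B (h : hom X (prd A B)),
    pair (pr1 A B ∘ h) (pr2 A B ∘ h) = h
}.
Arguments prd {_}.
Arguments pr1 {_ _ _}.
Arguments pr2 {_ _ _}.
Arguments pair {_ _ _ _}.

Notation "A × B" := (prd A B) (at level 40, left associativity) : doctrine_scope.
Notation "⟨ f , g ⟩" := (pair f g) (at level 0, f at level 99, g at level 99)
  : doctrine_scope.

Lemma pair_comp (C : ProdCategory) (X Y A B : C)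
    (f : hom X A) (g : hom X B) (h : hom Y X) :
  ⟨f, g⟩ ∘ h = ⟨f ∘ h, g ∘ h⟩.
Proof.
rewrite <- (pair_eta (⟨f, g⟩ ∘ h)), !comp_assoc, pair_pr1, pair_pr2.
reflexivity.
Qed.

Lemma pr_is_product (C : ProdCategory) (A B : C) :
  is_product (pr1 : hom (A × B) A) (pr2 : hom (A × B) B).
Proof.
intros X f g; exists ⟨f, g⟩; split.
- split; [apply pair_pr1 | apply pair_pr2].
- intros h [h1 h2]; rewrite <- h1, <- h2; apply pair_eta.
Qed.

Definition diag (C : ProdCategory) (A : C) : hom A (A × A) := ⟨idc A, idc A⟩.

Definition prod_map (C : ProdCategory) (A B A' B' : C)
    (f : hom A A') (g : hom B B') : hom (A × B) (A' × B') :=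
  ⟨f ∘ pr1, g ∘ pr2⟩.

Inductive is_projection (C : ProdCategory) : forall W Y : C, hom W Y -> Prop :=
| projection_1 X Y : is_projection (pr1 : hom (X × Y) X)
| projection_2 X Y : is_projection (pr2 : hom (X × Y) Y).

Record PrimaryDoctrine (C : ProdCategory) : Type := {
  fib :> C -> ISL;
  reindex : forall A B : C, hom A B -> ISLHom (fib B) (fib A);
  reindex_id : forall (A : C) (x : fib A), reindex (idc A) x = x;
  reindex_comp : forall (A B D : C) (g : hom B D) (f : hom A B) (x : fib D),
    reindex (g ∘ f) x = reindex f (reindex g x)
}.
Arguments reindex {_} _ {_ _}.

Definition has_finite_distributive_joins
    (C : ProdCategory) (P : PrimaryDoctrine C) : Prop :=
  (forall A : C, exists b : P A, is_bottom b) /\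
  (forall (A : C) (x y : P A), exists j, is_join x y j) /\
  (forall (A : C) (x y z j : P A),
     is_join y z j -> is_join (x ⊓ y) (x ⊓ z) (x ⊓ j)) /\
  (* Joins are part of the structure of the doctrine, hence stable under
     reindexing. Without stability a join of descent data need not be a descent
     datum: for subobjects of pointed sets, with the total relation on A, the
     bottom {*} of P(A) is not one. *)
  (forall (A B : C) (f : hom A B) (b : P B),
     is_bottom b -> is_bottom (reindex P f b)) /\
  (forall (A B : C) (f : hom A B) (x y j : P B),
     is_join x y j ->
     is_join (reindex P f x) (reindex P f y) (reindex P f j)).

Definition implicational (C : ProdCategory) (P : PrimaryDoctrine C) : Prop :=
  (forall (A : C) (x y : P A), exists r, is_rpc x y r) /\
  (forall (A B : C) (f : hom A B) (x y r : P B),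
     is_rpc x y r -> is_rpc (reindex P f x) (reindex P f y) (reindex P f r)).

(* Adjoints between posets are unique, so the Beck-Chevalley and Frobenius
   conditions may quantify over all of them. *)

Definition existential (C : ProdCategory) (P : PrimaryDoctrine C) : Prop :=
  (forall (W Y : C) (p : hom W Y), is_projection p ->
     exists E : P W -> P Y, left_adjoint E (reindex P p)) /\
  (forall (X Y Y' : C) (f : hom Y' Y)
     (E : P (X × Y) -> P Y) (E' : P (X × Y') -> P Y'),
     left_adjoint E (reindex P pr2) ->
     left_adjoint E' (reindex P pr2) ->
     forall a : P (X × Y),
       E' (reindex P (prod_map (idc X) f) a) = reindex P f (E a)) /\
  (forall (X Y : C) (E : P (X × Y) -> P Y),
     left_adjoint E (reindex P pr2) ->
     forall (a : P (X × Y)) (b : P Y),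
       E (a ⊓ reindex P pr2 b) = E a ⊓ b).

Definition universal (C : ProdCategory) (P : PrimaryDoctrine C) : Prop :=
  (forall (W Y : C) (p : hom W Y), is_projection p ->
     exists G : P W -> P Y, right_adjoint G (reindex P p)) /\
  (forall (X Y Y' : C) (f : hom Y' Y)
     (G : P (X × Y) -> P Y) (G' : P (X × Y') -> P Y'),
     right_adjoint G (reindex P pr2) ->
     right_adjoint G' (reindex P pr2) ->
     forall a : P (X × Y),
       G' (reindex P (prod_map (idc X) f) a) = reindex P f (G a)).

Definition is_comprehension (C : ProdCategory) (P : PrimaryDoctrine C)
    (A : C) (phi : P A) (X : C) (c : hom X A) : Prop :=
  ⊤ ≤ reindex P c phi /\
  forall (Y : C) (g : hom Y A), ⊤ ≤ reindex P g phi ->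
    exists! h : hom Y X, c ∘ h = g.

Definition is_full (C : ProdCategory) (P : PrimaryDoctrine C)
    (A : C) (phi : P A) (X : C) (c : hom X A) : Prop :=
  forall b : P A, ⊤ ≤ reindex P c b -> phi ≤ b.

Definition has_comprehensions (C : ProdCategory) (P : PrimaryDoctrine C) : Prop :=
  forall (A : C) (phi : P A),
    exists (X : C) (c : hom X A), is_comprehension phi c.

Definition has_full_comprehensions
    (C : ProdCategory) (P : PrimaryDoctrine C) : Prop :=
  has_comprehensions P /\
  forall (A : C) (phi : P A) (X : C) (c : hom X A),
    is_comprehension phi c -> is_full phi c.

Record Functor (C D : Category) : Type := {
  fob :> C -> D;
  fmap : forall A B : C, hom A B -> hom (fob A) (fob B);
  fmap_id : forall A : C, fmap (idc A) = idc (fob A);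
  fmap_comp : forall (A B E : C) (g : hom B E) (f : hom A B),
    fmap (g ∘ f) = fmap g ∘ fmap f
}.
Arguments fmap {_ _} _ {_ _}.

Record OneArrow (C D : ProdCategory)
    (P : PrimaryDoctrine C) (R : PrimaryDoctrine D) : Type := {
  arr_fun :> Functor C D;
  arr_prod : forall A B : C,
    is_product (fmap arr_fun (pr1 : hom (A × B) A))
               (fmap arr_fun (pr2 : hom (A × B) B));
  arr_fib : forall A : C, ISLHom (P A) (R (arr_fun A));
  arr_nat : forall (A B : C) (f : hom A B) (x : P B),
    arr_fib A (reindex P f x) = reindex R (fmap arr_fun f) (arr_fib B x)
}.
Arguments arr_fib {_ _ _ _} _ {_}.

Definition preserves_finite_joins (C D : ProdCategory)
    (P : PrimaryDoctrine C) (R : PrimaryDoctrine D) (e : OneArrow P R) : Prop :=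
  (forall (A : C) (b : P A), is_bottom b -> is_bottom (arr_fib e b)) /\
  (forall (A : C) (x y j : P A), is_join x y j ->
     is_join (arr_fib e x) (arr_fib e y) (arr_fib e j)).

Definition preserves_rpc (C D : ProdCategory)
    (P : PrimaryDoctrine C) (R : PrimaryDoctrine D) (e : OneArrow P R) : Prop :=
  forall (A : C) (x y r : P A), is_rpc x y r ->
    is_rpc (arr_fib e x) (arr_fib e y) (arr_fib e r).

Definition preserves_left_adjoints (C D : ProdCategory)
    (P : PrimaryDoctrine C) (R : PrimaryDoctrine D) (e : OneArrow P R) : Prop :=
  forall (W Y : C) (p : hom W Y), is_projection p ->
  forall (E : P W -> P Y) (E' : R (e W) -> R (e Y)),
    left_adjoint E (reindex P p) ->
    left_adjoint E' (reindex R (fmap e p)) ->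
    forall a : P W, arr_fib e (E a) = E' (arr_fib e a).

Definition preserves_right_adjoints (C D : ProdCategory)
    (P : PrimaryDoctrine C) (R : PrimaryDoctrine D) (e : OneArrow P R) : Prop :=
  forall (W Y : C) (p : hom W Y), is_projection p ->
  forall (G : P W -> P Y) (G' : R (e W) -> R (e Y)),
    right_adjoint G (reindex P p) ->
    right_adjoint G' (reindex R (fmap e p)) ->
    forall a : P W, arr_fib e (G a) = G' (arr_fib e a).

Definition preserves_comprehensions (C D : ProdCategory)
    (P : PrimaryDoctrine C) (R : PrimaryDoctrine D) (e : OneArrow P R) : Prop :=
  forall (A : C) (phi : P A) (X : C) (c : hom X A),
    is_comprehension phi c -> is_comprehension (arr_fib e phi) (fmap e c).

Definition is_equivalence (C : ProdCategory) (P : PrimaryDoctrine C)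
    (A : C) (rho : P (A × A)) : Prop :=
  ⊤ ≤ reindex P (diag A) rho /\
  rho ≤ reindex P ⟨pr2, pr1⟩ rho /\
  (let q1 : hom (A × A × A) A := pr1 ∘ pr1 in
   let q2 : hom (A × A × A) A := pr2 ∘ pr1 in
   let q3 : hom (A × A × A) A := pr2 in
   reindex P ⟨q1, q2⟩ rho ⊓ reindex P ⟨q2, q3⟩ rho ≤ reindex P ⟨q1, q3⟩ rho).

(* rho ⊠ sigma; the projections from the fourfold product (A × B) × (A × B)
   are the composites below. *)
Definition box (C : ProdCategory) (P : PrimaryDoctrine C) (A B : C)
    (rho : P (A × A)) (sigma : P (B × B)) : P ((A × B) × (A × B)) :=
  let q1 : hom ((A × B) × (A × B)) A := pr1 ∘ pr1 in
  let q2 : hom ((A × B) × (A × B)) B := pr2 ∘ pr1 in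
  let q3 : hom ((A × B) × (A × B)) A := pr1 ∘ pr2 in
  let q4 : hom ((A × B) × (A × B)) B := pr2 ∘ pr2 in
  reindex P ⟨q1, q3⟩ rho ⊓ reindex P ⟨q2, q4⟩ sigma.

Definition is_descent (C : ProdCategory) (P : PrimaryDoctrine C)
    (A : C) (rho : P (A × A)) (a : P A) : Prop :=
  reindex P pr1 a ⊓ rho ≤ reindex P pr2 a.

Record QObj (C : ProdCategory) (P : PrimaryDoctrine C) : Type := {
  qcar : C;
  qrel : P (qcar × qcar);
  qrel_equiv : is_equivalence qrel
}.

Record QHom (C : ProdCategory) (P : PrimaryDoctrine C) (A B : QObj P) : Type := {
  qmap : hom (qcar A) (qcar B);
  qmap_rel : qrel A ≤ reindex P (prod_map qmap qmap) (qrel B)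
}.

Ltac simp_cat :=
  unfold prod_map, diag;
  repeat first
    [ rewrite <- reindex_comp
    | rewrite isl_meet
    | rewrite pair_comp
    | rewrite pair_pr1
    | rewrite pair_pr2
    | rewrite comp_id_l
    | rewrite comp_id_r
    | rewrite <- comp_assoc ].

Lemma QHom_eq (C : ProdCategory) (P : PrimaryDoctrine C) (A B : QObj P)
    (f g : QHom A B) : qmap f = qmap g -> f = g.
Proof.
destruct f as [f hf], g as [g hg]; simpl; intros e; subst g.
f_equal; apply proof_irrelevance.
Qed.

Lemma prod_map_id (C : ProdCategory) (A B : C) :
  prod_map (idc A) (idc B) = idc (A × B).
Proof.
rewrite <- (pair_eta (idc (A × B))); unfold prod_map.
rewrite !comp_id_l, !comp_id_r; reflexivity.
Qed.

Lemma qid_rel (C : ProdCategory) (P : PrimaryDoctrine C) (A : QObj P) :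
  qrel A ≤ reindex P (prod_map (idc (qcar A)) (idc (qcar A))) (qrel A).
Proof. rewrite prod_map_id, reindex_id; apply le_refl. Qed.

Lemma qcomp_rel (C : ProdCategory) (P : PrimaryDoctrine C) (A B D : QObj P)
    (g : QHom B D) (f : QHom A B) :
  qrel A ≤ reindex P (prod_map (qmap g ∘ qmap f) (qmap g ∘ qmap f)) (qrel D).
Proof.
apply (le_trans (qmap_rel f)).
apply (le_trans (isl_mono _ (qmap_rel g))).
simp_cat; apply le_refl.
Qed.

Definition qid (C : ProdCategory) (P : PrimaryDoctrine C) (A : QObj P) : QHom A A :=
  {| qmap := idc (qcar A); qmap_rel := qid_rel A |}.

Definition qcomp (C : ProdCategory) (P : PrimaryDoctrine C) (A B D : QObj P)
    (g : QHom B D) (f : QHom A B) : QHom A D :=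
  {| qmap := qmap g ∘ qmap f; qmap_rel := qcomp_rel g f |}.

Definition QCat (C : ProdCategory) (P : PrimaryDoctrine C) : Category.
Proof.
refine {| ob := QObj P; hom := @QHom C P; idc := @qid C P; comp := @qcomp C P |}.
- intros; apply QHom_eq, comp_id_l.
- intros; apply QHom_eq, comp_id_r.
- intros; apply QHom_eq, comp_assoc.
Defined.

Lemma box_equiv (C : ProdCategory) (P : PrimaryDoctrine C) (A B : C)
    (rho : P (A × A)) (sigma : P (B × B)) :
  is_equivalence rho -> is_equivalence sigma -> is_equivalence (box rho sigma).
Proof.
intros [r1 [r2 r3]] [s1 [s2 s3]]; unfold box; cbv zeta.
repeat split.
- rewrite isl_meet; apply meet_glb.
  + apply le_trans with (reindex P pr1 (reindex P (diag A) rho)).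
    * rewrite <- (isl_top (reindex P pr1)); apply isl_mono, r1.
    * simp_cat; apply le_refl.
  + apply le_trans with (reindex P pr2 (reindex P (diag B) sigma)).
    * rewrite <- (isl_top (reindex P pr2)); apply isl_mono, s1.
    * simp_cat; apply le_refl.
- rewrite isl_meet; apply meet_mono.
  + apply (le_trans (isl_mono _ r2)); simp_cat; apply le_refl.
  + apply (le_trans (isl_mono _ s2)); simp_cat; apply le_refl.
- cbv zeta in r3, s3 |- *; rewrite isl_meet, isl_meet, isl_meet.
  apply meet_glb.
  + apply le_trans with
      (reindex P ⟨⟨pr1 ∘ (pr1 ∘ pr1), pr1 ∘ (pr2 ∘ pr1)⟩, pr1 ∘ pr2⟩
        (reindex P ⟨pr1 ∘ pr1, pr2 ∘ pr1⟩ rho ⊓ reindex P ⟨pr2 ∘ pr1, pr2⟩ rho)).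
    * rewrite isl_meet; apply meet_mono.
      -- refine (le_trans (meet_le_l _ _) _); simp_cat; apply le_refl.
      -- refine (le_trans (meet_le_l _ _) _); simp_cat; apply le_refl.
    * refine (le_trans (isl_mono _ r3) _); simp_cat; apply le_refl.
  + apply le_trans with
      (reindex P ⟨⟨pr2 ∘ (pr1 ∘ pr1), pr2 ∘ (pr2 ∘ pr1)⟩, pr2 ∘ pr2⟩
        (reindex P ⟨pr1 ∘ pr1, pr2 ∘ pr1⟩ sigma ⊓ reindex P ⟨pr2 ∘ pr1, pr2⟩ sigma)).
    * rewrite isl_meet; apply meet_mono.
      -- refine (le_trans (meet_le_r _ _) _); simp_cat; apply le_refl.
      -- refine (le_trans (meet_le_r _ _) _); simp_cat; apply le_refl.
    * refine (le_trans (isl_mono _ s3) _); simp_cat; apply le_refl.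
Qed.

Definition qprd (C : ProdCategory) (P : PrimaryDoctrine C) (A B : QObj P) : QObj P :=
  {| qcar := qcar A × qcar B;
     qrel := box (qrel A) (qrel B);
     qrel_equiv := box_equiv (qrel_equiv A) (qrel_equiv B) |}.

Definition qpr1 (C : ProdCategory) (P : PrimaryDoctrine C) (A B : QObj P) :
    QHom (qprd A B) A :=
  {| qmap := pr1 : hom (qcar (qprd A B)) (qcar A);
     qmap_rel := meet_le_l _ _ |}.

Definition qpr2 (C : ProdCategory) (P : PrimaryDoctrine C) (A B : QObj P) :
    QHom (qprd A B) B :=
  {| qmap := pr2 : hom (qcar (qprd A B)) (qcar B);
     qmap_rel := meet_le_r _ _ |}.

Lemma qpair_rel (C : ProdCategory) (P : PrimaryDoctrine C) (X A B : QObj P)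
    (f : QHom X A) (g : QHom X B) :
  qrel X ≤ reindex P (prod_map ⟨qmap f, qmap g⟩ ⟨qmap f, qmap g⟩)
             (box (qrel A) (qrel B)).
Proof.
unfold box; cbv zeta; rewrite isl_meet; apply meet_glb.
- apply (le_trans (qmap_rel f)); simp_cat; apply le_refl.
- apply (le_trans (qmap_rel g)); simp_cat; apply le_refl.
Qed.

Definition qpair (C : ProdCategory) (P : PrimaryDoctrine C) (X A B : QObj P)
    (f : QHom X A) (g : QHom X B) : QHom X (qprd A B) :=
  {| qmap := ⟨qmap f, qmap g⟩ : hom (qcar X) (qcar (qprd A B));
     qmap_rel := qpair_rel f g |}.

Definition QProdCat (C : ProdCategory) (P : PrimaryDoctrine C) : ProdCategory.
Proof.
refine {| pcat := QCat P; prd := @qprd C P; pr1 := @qpr1 C P; pr2 := @qpr2 C P;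
          pair := @qpair C P |}.
- intros; apply QHom_eq, pair_pr1.
- intros; apply QHom_eq, pair_pr2.
- intros; apply QHom_eq, pair_eta.
Defined.

Lemma Des_eq (C : ProdCategory) (P : PrimaryDoctrine C) (A : QObj P)
    (a b : {a : P (qcar A) | is_descent (qrel A) a}) :
  proj1_sig a = proj1_sig b -> a = b.
Proof.
destruct a as [a ha], b as [b hb]; simpl; intros e; subst b.
f_equal; apply proof_irrelevance.
Qed.

Lemma top_descent (C : ProdCategory) (P : PrimaryDoctrine C)
    (A : C) (rho : P (A × A)) : is_descent rho ⊤.
Proof. unfold is_descent; rewrite (isl_top (reindex P pr2)); apply le_top. Qed.

Lemma meet_descent (C : ProdCategory) (P : PrimaryDoctrine C)
    (A : C) (rho : P (A × A)) (a b : P A) :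
  is_descent rho a -> is_descent rho b -> is_descent rho (a ⊓ b).
Proof.
unfold is_descent; intros ha hb; rewrite !isl_meet; apply meet_glb.
- refine (le_trans _ ha); apply meet_mono; [apply meet_le_l | apply le_refl].
- refine (le_trans _ hb); apply meet_mono; [apply meet_le_r | apply le_refl].
Qed.

Lemma reindex_descent (C : ProdCategory) (P : PrimaryDoctrine C) (A B : QObj P)
    (f : QHom A B) (b : P (qcar B)) :
  is_descent (qrel B) b -> is_descent (qrel A) (reindex P (qmap f) b).
Proof.
unfold is_descent; intros hb.
apply le_trans with (reindex P (prod_map (qmap f) (qmap f))
                       (reindex P pr1 b ⊓ qrel B)).
- rewrite isl_meet; apply meet_mono; [simp_cat; apply le_refl | apply qmap_rel].
- refine (le_trans (isl_mono _ hb) _); simp_cat; apply le_refl.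
Qed.

Definition Des (C : ProdCategory) (P : PrimaryDoctrine C) (A : QObj P) : ISL.
Proof.
refine {|
  carrier := {a : P (qcar A) | is_descent (qrel A) a};
  le := fun a b => proj1_sig a ≤ proj1_sig b;
  top := exist _ ⊤ (top_descent (qrel A));
  meet := fun a b => exist _ (proj1_sig a ⊓ proj1_sig b)
                       (meet_descent (proj2_sig a) (proj2_sig b)) |}.
- split.
  + intros a; apply le_refl.
  + intros a b c; apply le_trans.
  + intros a b h k; apply Des_eq, le_antisym; assumption.
- intros a; apply le_top.
- intros a b c; apply le_meet.
Defined.

Definition des_incl (C : ProdCategory) (P : PrimaryDoctrine C) (A : QObj P) :
    ISLHom (Des A) (P (qcar A)) :=
  {| isl_fun := fun a : Des A => proj1_sig a;
     isl_top := eq_refl;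
     isl_meet := fun _ _ => eq_refl |}.

Definition des_reindex (C : ProdCategory) (P : PrimaryDoctrine C) (A B : QObj P)
    (f : QHom A B) : ISLHom (Des B) (Des A).
Proof.
refine {|
  isl_fun := fun b : Des B =>
    exist _ (reindex P (qmap f) (proj1_sig b)) (reindex_descent f (proj2_sig b))
    : Des A |}.
- apply Des_eq, isl_top.
- intros; apply Des_eq, isl_meet.
Defined.

Definition descent_doctrine (C : ProdCategory) (P : PrimaryDoctrine C) :
  PrimaryDoctrine (QProdCat P).
Proof.
refine {| fib := (@Des C P : QProdCat P -> ISL); reindex := @des_reindex C P |}.
- intros; apply Des_eq, reindex_id.
- intros; apply Des_eq, reindex_comp.
Defined.

Definition forget_functor (C : ProdCategory) (P : PrimaryDoctrine C) :
    Functor (QProdCat P) C :=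
  {| fob := (@qcar C P : QProdCat P -> C);
     fmap := @qmap C P;
     fmap_id := fun _ => eq_refl;
     fmap_comp := fun _ _ _ _ _ => eq_refl |}.

Definition descent_arrow (C : ProdCategory) (P : PrimaryDoctrine C) :
    OneArrow (descent_doctrine P) P :=
  @Build_OneArrow (QProdCat P) C (descent_doctrine P) P
    (forget_functor P)
    (fun A B => @pr_is_product C (qcar A) (qcar B))
    (fun A => des_incl A)
    (fun _ _ _ _ => eq_refl).

(* Main.v *)
(* Each operation of [P], applied to descent data, yields a descent datum again;
   an operation defined by a universal property in [P] then has the same property
   in the full sub-poset [Des], and by uniqueness every choice of it in [Des] is
   the one of [P].  For quantifiers along [X × Y → Y], the equivalence on [X] only
   enters through its reflexivity: transport along [sigma] with the [X]-component
   kept fixed.  A comprehension [c : X → A] of a descent datum for [rho] lifts to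
   [X] with the relation [(c × c)^* rho]. *)

Require Import Defs.

Set Implicit Arguments.
Unset Strict Implicit.
Unset Printing Implicit Defensive.
Local Open Scope doctrine_scope.

(** * Uniqueness of operations given by universal properties *)

Lemma bottom_unique (L : ISL) (b c : L) : is_bottom b -> is_bottom c -> b = c.
Proof. intros hb hc; apply le_antisym; [apply hb | apply hc]. Qed.

Lemma join_unique (L : ISL) (x y j k : L) : is_join x y j -> is_join x y k -> j = k.
Proof.
intros hj hk; apply le_antisym.
- apply hj, hk, le_refl.
- apply hk, hj, le_refl.
Qed.

Lemma rpc_unique (L : ISL) (x y r s : L) : is_rpc x y r -> is_rpc x y s -> r = s.
Proof.
intros hr hs; apply le_antisym.
- apply hs, hr, le_refl.
- apply hr, hs, le_refl.
Qed.

Lemma left_adjoint_unique (L M : ISL) (f : ISLHom L M) (E F : M -> L) :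
  left_adjoint E f -> left_adjoint F f -> forall a, E a = F a.
Proof.
intros hE hF a; apply le_antisym.
- apply hE, hF, le_refl.
- apply hF, hE, le_refl.
Qed.

Lemma right_adjoint_unique (L M : ISL) (f : ISLHom L M) (G H : M -> L) :
  right_adjoint G f -> right_adjoint H f -> forall a, G a = H a.
Proof.
intros hG hH a; apply le_antisym.
- apply hH, hG, le_refl.
- apply hG, hH, le_refl.
Qed.

Lemma meetC (L : ISL) (x y : L) : x ⊓ y = y ⊓ x.
Proof. apply le_antisym; apply meet_glb; auto using meet_le_l, meet_le_r. Qed.

(** * Transport of descent data between generalized elements *)

Lemma descent_along (C : ProdCategory) (P : PrimaryDoctrine C) (A X : C)
    (rho : P (A × A)) (a : P A) (f g : hom X A) :
  is_descent rho a -> reindex P f a ⊓ reindex P ⟨f, g⟩ rho ≤ reindex P g a.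
Proof.
intros ha; generalize (isl_mono (reindex P ⟨f, g⟩) ha); simp_cat; trivial.
Qed.

Lemma equivalence_sym (C : ProdCategory) (P : PrimaryDoctrine C) (A : C)
    (rho : P (A × A)) :
  is_equivalence rho -> rho ≤ reindex P ⟨pr2, pr1⟩ rho.
Proof. intros h; apply h. Qed.

Lemma reindex_pair_refl (C : ProdCategory) (P : PrimaryDoctrine C) (A X : C)
    (rho : P (A × A)) (f : hom X A) :
  is_equivalence rho -> ⊤ ≤ reindex P ⟨f, f⟩ rho.
Proof.
intros [h _]; generalize (isl_mono (reindex P f) h).
rewrite isl_top; simp_cat; trivial.
Qed.

(** The two maps into [X × Y] agree in their [X]-component, so reflexivity of [rho] discharges the
    first half of [box rho sigma] and only [sigma] has to be assumed. *)
Lemma descent_along_snd (C : ProdCategory) (P : PrimaryDoctrine C) (X Y : C)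
    (rho : P (X × X)) (sigma : P (Y × Y)) (a : P (X × Y)) :
  is_equivalence rho -> is_descent (box rho sigma) a ->
  reindex P (prod_map (idc X) pr1) a ⊓ reindex P pr2 sigma
    ≤ reindex P (prod_map (idc X) pr2) a.
Proof.
intros hr ha.
refine (le_trans _ (descent_along (prod_map (idc X) pr1) (prod_map (idc X) pr2) ha)).
apply meet_mono; [apply le_refl |].
unfold box; cbv zeta; simp_cat; apply meet_glb.
- refine (le_trans (le_top _) (reindex_pair_refl _ hr)).
(* The pair left by [simp_cat] consists of the two components of [pr2], hence is [pr2] itself. *)
- rewrite pair_eta; apply le_refl.
Qed.

(** * Closure of descent data under the operations of [P] *)

Lemma bottom_descent (C : ProdCategory) (P : PrimaryDoctrine C) (A : C)
    (rho : P (A × A)) (b : P A) :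
  has_finite_distributive_joins P -> is_bottom b -> is_descent rho b.
Proof.
intros [_ [_ [_ [hf _]]]] hb; refine (le_trans (meet_le_l _ _) _).
apply (hf _ _ _ _ hb).
Qed.

(** By stability [reindex P pr1 j] is again a join; distributing [rho] over it leaves one case for
    [x] and one for [y], each settled by its own descent inequality. *)
Lemma join_descent (C : ProdCategory) (P : PrimaryDoctrine C) (A : C)
    (rho : P (A × A)) (x y j : P A) :
  has_finite_distributive_joins P -> is_descent rho x -> is_descent rho y ->
  is_join x y j -> is_descent rho j.
Proof.
intros [_ [_ [hd [_ hf]]]] hx hy hj; unfold is_descent in *.
destruct (proj1 (hj j) (le_refl _)) as [jx jy].
rewrite meetC in hx, hy |- *; apply (hd _ _ _ _ _ (hf _ _ _ _ _ _ hj)); split.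
- exact (le_trans hx (isl_mono _ jx)).
- exact (le_trans hy (isl_mono _ jy)).
Qed.

(** The premise [x] is contravariant: it is carried back from the second coordinate to the first by
    symmetry of [rho], modus ponens with [r] is applied there, and the resulting [y] is carried
    forward again. *)
Lemma rpc_descent (C : ProdCategory) (P : PrimaryDoctrine C) (A : C)
    (rho : P (A × A)) (x y r : P A) :
  implicational P -> is_equivalence rho -> is_descent rho x -> is_descent rho y ->
  is_rpc x y r -> is_descent rho r.
Proof.
intros [_ hf] he hx hy hr; unfold is_descent.
apply (hf _ _ pr2 _ _ _ hr).
refine (le_trans _ hy); apply meet_glb.
- apply le_trans with (reindex P pr1 r ⊓ reindex P pr1 x);
    [| apply (hf _ _ pr1 _ _ _ hr), le_refl].
  apply meet_glb.
  + exact (le_trans (meet_le_l _ _) (meet_le_l _ _)).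
  + refine (le_trans _ (descent_along pr2 pr1 hx)); rewrite meetC.
    apply meet_mono; [apply le_refl |].
    exact (le_trans (meet_le_r _ _) (equivalence_sym he)).
- exact (le_trans (meet_le_l _ _) (meet_le_r _ _)).
Qed.

(** Beck-Chevalley along [pr1 : Y × Y → Y] and Frobenius bring [sigma] under a quantifier [E'] over
    [X × (Y × Y)]. By adjunction it remains to transport [a] with its [X]-component fixed and to
    apply the unit of [E]. *)
Lemma left_adjoint_descent (C : ProdCategory) (P : PrimaryDoctrine C) (X Y : C)
    (rho : P (X × X)) (sigma : P (Y × Y)) (E : P (X × Y) -> P Y) (a : P (X × Y)) :
  existential P -> is_equivalence rho -> left_adjoint E (reindex P pr2) ->
  is_descent (box rho sigma) a -> is_descent sigma (E a).
Proof.
intros [hex [hbc hfr]] hr hE ha; unfold is_descent.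
destruct (hex _ _ _ (projection_2 X (Y × Y))) as [E' hE'].
rewrite <- (hbc _ _ _ pr1 _ _ hE hE'), <- (hfr _ _ _ hE'); apply hE'.
refine (le_trans (descent_along_snd hr ha) _).
generalize (isl_mono (reindex P (prod_map (idc X) (pr2 : hom (Y × Y) Y))) (proj1 (hE a _) (le_refl _))).
simp_cat; trivial.
Qed.

(** Beck-Chevalley is used at the target, along [pr2 : Y × Y → Y]. After adjunction the counit of
    [G], reindexed along [prod_map (idc X) pr1], yields [a] at the first [Y]-component, and
    transport moves it to the second. *)
Lemma right_adjoint_descent (C : ProdCategory) (P : PrimaryDoctrine C) (X Y : C)
    (rho : P (X × X)) (sigma : P (Y × Y)) (G : P (X × Y) -> P Y) (a : P (X × Y)) :
  universal P -> is_equivalence rho -> right_adjoint G (reindex P pr2) ->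
  is_descent (box rho sigma) a -> is_descent sigma (G a).
Proof.
intros [hun hbc] hr hG ha; unfold is_descent.
destruct (hun _ _ _ (projection_2 X (Y × Y))) as [G' hG'].
rewrite <- (hbc _ _ _ pr2 _ _ hG hG'); apply hG'.
refine (le_trans _ (descent_along_snd hr ha)); rewrite isl_meet.
apply meet_mono; [| apply le_refl].
generalize (isl_mono (reindex P (prod_map (idc X) (pr1 : hom (Y × Y) Y))) (proj2 (hG a _) (le_refl _))).
simp_cat; trivial.
Qed.

(** * Quantifiers along first projections, by exchange of factors *)

Definition swap (C : ProdCategory) (A B : C) : hom (A × B) (B × A) := ⟨pr2, pr1⟩.

(** The two swaps are mutually inverse, so reindexing along one is both left and right adjoint to
    reindexing along the other. *)
Lemma swap_le (C : ProdCategory) (P : PrimaryDoctrine C) (A B : C)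
    (a : P (B × A)) (b : P (A × B)) :
  reindex P (swap A B) a ≤ b <-> a ≤ reindex P (swap B A) b.
Proof.
assert (e : forall A B : C, swap B A ∘ swap A B = idc (A × B)).
{ clear; intros A B; unfold swap; rewrite pair_comp, pair_pr1, pair_pr2.
  rewrite <- (pair_eta (idc (A × B))), !comp_id_r; reflexivity. }
split; intros h.
- rewrite <- (reindex_id a), <- e, reindex_comp; apply isl_mono, h.
- rewrite <- (reindex_id b), <- e, reindex_comp; apply isl_mono, h.
Qed.

(** Beck-Chevalley and Frobenius are stated for second projections; since [pr1] is [pr2] after a
    swap, quantifiers along [pr1] reduce to those. *)
Lemma left_adjoint_swap (C : ProdCategory) (P : PrimaryDoctrine C) (X Y : C)
    (E : P (Y × X) -> P X) :
  left_adjoint E (reindex P pr2) ->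
  left_adjoint (fun a => E (reindex P (swap Y X) a))
    (reindex P (pr1 : hom (X × Y) X)).
Proof.
intros hE a b.
assert (e : pr2 ∘ swap X Y = pr1) by apply pair_pr2.
rewrite <- e, reindex_comp.
exact (iff_trans (hE _ b) (swap_le a _)).
Qed.

Lemma right_adjoint_swap (C : ProdCategory) (P : PrimaryDoctrine C) (X Y : C)
    (G : P (Y × X) -> P X) :
  right_adjoint G (reindex P pr2) ->
  right_adjoint (fun a => G (reindex P (swap Y X) a))
    (reindex P (pr1 : hom (X × Y) X)).
Proof.
intros hG a b.
assert (e : pr2 ∘ swap X Y = pr1) by apply pair_pr2.
rewrite <- e, reindex_comp.
exact (iff_trans (swap_le _ a) (hG _ b)).
Qed.

(** The swap underlies an arrow of [QCat P], so this is an instance of stability of descent data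
    under reindexing. *)
Lemma descent_swap (C : ProdCategory) (P : PrimaryDoctrine C) (A B : QObj P)
    (a : P (qcar B × qcar A)) :
  is_descent (box (qrel B) (qrel A)) a ->
  is_descent (box (qrel A) (qrel B)) (reindex P (swap (qcar A) (qcar B)) a).
Proof. exact (reindex_descent (qpair (qpr2 A B) (qpr1 A B)) (b := a)). Qed.

(** An adjoint of [P] that restricts to descent data serves both for existence in
    [descent_doctrine P] and, by uniqueness, for preservation. *)
Lemma left_adjoint_descends (C : ProdCategory) (P : PrimaryDoctrine C)
    (W Y : QProdCat P) (p : hom W Y) :
  existential P -> is_projection p ->
  exists E : P (qcar W) -> P (qcar Y), left_adjoint E (reindex P (qmap p)) /\
    forall a, is_descent (qrel W) a -> is_descent (qrel Y) (E a).
Proof.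
intros hP hp; destruct hp as [X Y | X Y].
- destruct (proj1 hP _ _ _ (projection_2 (qcar Y) (qcar X))) as [E hE].
  exists (fun a => E (reindex P (swap (qcar Y) (qcar X)) a)); split.
  + exact (left_adjoint_swap hE).
  + intros a ha.
    exact (left_adjoint_descent hP (qrel_equiv Y) hE (descent_swap (A := Y) ha)).
- destruct (proj1 hP _ _ _ (projection_2 (qcar X) (qcar Y))) as [E hE].
  exists E; split; [exact hE |].
  intros a; exact (left_adjoint_descent hP (qrel_equiv X) hE).
Qed.

Lemma right_adjoint_descends (C : ProdCategory) (P : PrimaryDoctrine C)
    (W Y : QProdCat P) (p : hom W Y) :
  universal P -> is_projection p ->
  exists G : P (qcar W) -> P (qcar Y), right_adjoint G (reindex P (qmap p)) /\
    forall a, is_descent (qrel W) a -> is_descent (qrel Y) (G a).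
Proof.
intros hP hp; destruct hp as [X Y | X Y].
- destruct (proj1 hP _ _ _ (projection_2 (qcar Y) (qcar X))) as [G hG].
  exists (fun a => G (reindex P (swap (qcar Y) (qcar X)) a)); split.
  + exact (right_adjoint_swap hG).
  + intros a ha.
    exact (right_adjoint_descent hP (qrel_equiv Y) hG (descent_swap (A := Y) ha)).
- destruct (proj1 hP _ _ _ (projection_2 (qcar X) (qcar Y))) as [G hG].
  exists G; split; [exact hG |].
  intros a; exact (right_adjoint_descent hP (qrel_equiv X) hG).
Qed.

(** * Logical structure of the descent doctrine and its preservation *)

Lemma descent_preserves_finite_joins (C : ProdCategory) (P : PrimaryDoctrine C) :
  has_finite_distributive_joins P -> preserves_finite_joins (descent_arrow P).
Proof.
intros hP; split.
- intros A b hb; destruct (proj1 hP (qcar A)) as [c hc].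
  set (c' := exist _ c (bottom_descent (qrel A) hP hc) : Des A).
  assert (hc' : is_bottom c') by (intros x; apply hc).
  rewrite (bottom_unique hb hc'); exact hc.
- intros A x y j hj.
  destruct (proj1 (proj2 hP) (qcar A) (proj1_sig x) (proj1_sig y)) as [k hk].
  set (k' := exist _ k (join_descent hP (proj2_sig x) (proj2_sig y) hk) : Des A).
  assert (hk' : is_join x y k') by (intros z; apply hk).
  rewrite (join_unique hj hk'); exact hk.
Qed.

Lemma descent_finite_distributive_joins (C : ProdCategory) (P : PrimaryDoctrine C) :
  has_finite_distributive_joins P ->
  has_finite_distributive_joins (descent_doctrine P).
Proof.
intros hP; destruct (descent_preserves_finite_joins hP) as [pb pj].
pose proof hP as [hb [hj [hd [hfb hfj]]]].
refine (conj _ (conj _ (conj _ (conj _ _)))).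
- intros A; destruct (hb (qcar A)) as [c hc].
  exists (exist _ c (bottom_descent (qrel A) hP hc)); intros x; apply hc.
- intros A x y; destruct (hj (qcar A) (proj1_sig x) (proj1_sig y)) as [k hk].
  exists (exist _ k (join_descent hP (proj2_sig x) (proj2_sig y) hk)).
  intros z; apply hk.
(* Preservation turns a join of descent data into a join in [P], where the law is available; its
   conclusion is then tested only against descent data. *)
- intros A x y z j h w; apply (hd _ (proj1_sig x) _ _ _ (pj _ _ _ _ h)).
- intros A B f b h x; apply (hfb _ _ (qmap f) _ (pb _ _ h)).
- intros A B f x y j h w; apply (hfj _ _ (qmap f) _ _ _ (pj _ _ _ _ h)).
Qed.

Lemma descent_preserves_rpc (C : ProdCategory) (P : PrimaryDoctrine C) :
  implicational P -> preserves_rpc (descent_arrow P).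
Proof.
intros hP A x y r hr.
destruct (proj1 hP (qcar A) (proj1_sig x) (proj1_sig y)) as [s hs].
set (s' := exist _ s
  (rpc_descent hP (qrel_equiv A) (proj2_sig x) (proj2_sig y) hs) : Des A).
assert (hs' : is_rpc x y s') by (intros z; apply hs).
rewrite (rpc_unique hr hs'); exact hs.
Qed.

Lemma descent_implicational (C : ProdCategory) (P : PrimaryDoctrine C) :
  implicational P -> implicational (descent_doctrine P).
Proof.
intros hP; split.
- intros A x y; destruct (proj1 hP (qcar A) (proj1_sig x) (proj1_sig y)) as [s hs].
  exists (exist _ s
    (rpc_descent hP (qrel_equiv A) (proj2_sig x) (proj2_sig y) hs)).
  intros z; apply hs.
- intros A B f x y r hr z.
  apply (proj2 hP _ _ (qmap f) _ _ _ (descent_preserves_rpc hP hr)).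
Qed.

Lemma descent_preserves_left_adjoints (C : ProdCategory) (P : PrimaryDoctrine C) :
  existential P -> preserves_left_adjoints (descent_arrow P).
Proof.
intros hP W Y p hp E E' hE hE' a.
destruct (left_adjoint_descends hP hp) as [F [hF dF]].
set (F' := fun a : Des W => exist _ (F (proj1_sig a)) (dF _ (proj2_sig a)) : Des Y).
assert (hF' : left_adjoint F' (reindex (descent_doctrine P) p))
  by (intros x y; apply hF).
(* Uniqueness is used twice: in [Des] to identify [E] with the restriction [F'], and in [P] to
   identify [F] with [E']. *)
rewrite (left_adjoint_unique hE hF'); exact (left_adjoint_unique hF hE' _).
Qed.

Lemma descent_existential (C : ProdCategory) (P : PrimaryDoctrine C) :
  existential P -> existential (descent_doctrine P).
Proof.
intros hP; pose proof (descent_preserves_left_adjoints hP) as pe.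
pose proof hP as [hex [hbc hfr]]; refine (conj _ (conj _ _)).
- intros W Y p hp; destruct (left_adjoint_descends hP hp) as [F [hF dF]].
  exists (fun a : Des W => exist _ (F (proj1_sig a)) (dF _ (proj2_sig a)) : Des Y).
  intros x y; apply hF.
- intros X Y Y' f E E' hE hE' a; apply Des_eq.
  destruct (hex _ _ _ (projection_2 (qcar X) (qcar Y))) as [F hF].
  destruct (hex _ _ _ (projection_2 (qcar X) (qcar Y'))) as [F' hF'].
  (* Preservation replaces the adjoints on descent data by [F] and [F'], for which Beck-Chevalley
     holds in [P]; the last step goes back. *)
  refine (eq_trans (pe _ _ _ (projection_2 X Y') _ _ hE' hF' _) _).
  refine (eq_trans (hbc _ _ _ (qmap f) _ _ hF hF' _) _).
  exact (f_equal _ (eq_sym (pe _ _ _ (projection_2 X Y) _ _ hE hF a))).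
- intros X Y E hE a b; apply Des_eq.
  destruct (hex _ _ _ (projection_2 (qcar X) (qcar Y))) as [F hF].
  refine (eq_trans (pe _ _ _ (projection_2 X Y) _ _ hE hF _) _).
  refine (eq_trans (hfr _ _ _ hF _ _) _).
  exact (f_equal (fun z => z ⊓ _) (eq_sym (pe _ _ _ (projection_2 X Y) _ _ hE hF a))).
Qed.

Lemma descent_preserves_right_adjoints (C : ProdCategory) (P : PrimaryDoctrine C) :
  universal P -> preserves_right_adjoints (descent_arrow P).
Proof.
intros hP W Y p hp G G' hG hG' a.
destruct (right_adjoint_descends hP hp) as [F [hF dF]].
set (F' := fun a : Des W => exist _ (F (proj1_sig a)) (dF _ (proj2_sig a)) : Des Y).
assert (hF' : right_adjoint F' (reindex (descent_doctrine P) p))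
  by (intros x y; apply hF).
rewrite (right_adjoint_unique hG hF'); exact (right_adjoint_unique hF hG' _).
Qed.

Lemma descent_universal (C : ProdCategory) (P : PrimaryDoctrine C) :
  universal P -> universal (descent_doctrine P).
Proof.
intros hP; pose proof (descent_preserves_right_adjoints hP) as pu.
pose proof hP as [hun hbc]; split.
- intros W Y p hp; destruct (right_adjoint_descends hP hp) as [F [hF dF]].
  exists (fun a : Des W => exist _ (F (proj1_sig a)) (dF _ (proj2_sig a)) : Des Y).
  intros x y; apply hF.
- intros X Y Y' f G G' hG hG' a; apply Des_eq.
  destruct (hun _ _ _ (projection_2 (qcar X) (qcar Y))) as [F hF].
  destruct (hun _ _ _ (projection_2 (qcar X) (qcar Y'))) as [F' hF'].
  refine (eq_trans (pu _ _ _ (projection_2 X Y') _ _ hG' hF' _) _).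
  refine (eq_trans (hbc _ _ _ (qmap f) _ _ hF hF' _) _).
  exact (f_equal _ (eq_sym (pu _ _ _ (projection_2 X Y) _ _ hG hF a))).
Qed.

(** * Comprehensions of descent data *)

Lemma pullback_equivalence (C : ProdCategory) (P : PrimaryDoctrine C) (A X : C)
    (f : hom X A) (rho : P (A × A)) :
  is_equivalence rho -> is_equivalence (reindex P (prod_map f f) rho).
Proof.
intros [h1 [h2 h3]]; cbv zeta in h3; repeat split.
- rewrite <- (isl_top (reindex P f)); refine (le_trans (isl_mono _ h1) _).
  simp_cat; apply le_refl.
- refine (le_trans (isl_mono _ h2) _); simp_cat; apply le_refl.
- cbv zeta; generalize (isl_mono (reindex P (prod_map (prod_map f f) f)) h3).
  simp_cat; trivial.
Qed.

(** This is the greatest relation on [X] that makes [f] an arrow into [A], so compatibility of a map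
    into [X] can be tested after composing with [f]. *)
Definition pullback_obj (C : ProdCategory) (P : PrimaryDoctrine C) (A : QObj P)
    (X : C) (f : hom X (qcar A)) : QObj P :=
  {| qcar := X;
     qrel := reindex P (prod_map f f) (qrel A);
     qrel_equiv := pullback_equivalence f (qrel_equiv A) |}.

Definition pullback_hom (C : ProdCategory) (P : PrimaryDoctrine C) (A : QObj P)
    (X : C) (f : hom X (qcar A)) : QHom (pullback_obj f) A :=
  {| qmap := f : hom (qcar (pullback_obj f)) (qcar A);
     qmap_rel := le_refl _ |}.

Lemma pullback_comprehension (C : ProdCategory) (P : PrimaryDoctrine C)
    (A : QProdCat P) (phi : descent_doctrine P A) (X : C) (c : hom X (qcar A)) :
  is_comprehension (arr_fib (descent_arrow P) phi) c ->
  is_comprehension phi (pullback_hom c : hom (pullback_obj c : QProdCat P) A).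
Proof.
intros [hc uc]; split; [exact hc |].
intros Y g hg; destruct (uc (qcar Y) (qmap g) hg) as [h [eh uh]].
(* As [c ∘ h] is [qmap g], pulling the relation of [A] back along [c] and then [h] is pulling it
   back along [qmap g]. *)
assert (hr : qrel Y ≤ reindex P (prod_map h h) (qrel (pullback_obj c))).
{ refine (le_trans (qmap_rel g) _); rewrite <- eh; simpl; simp_cat; apply le_refl. }
exists (Build_QHom (A := Y) (B := pullback_obj c) hr); split.
- apply QHom_eq; exact eh.
- intros k ek; apply QHom_eq, uh; exact (f_equal (@qmap _ _ _ _) ek).
Qed.

(** A factorization [h] through [c] gives [u ∘ h] through [c']. Conversely, [k] through [c'] gives
    [v ∘ k] through [c], so [v ∘ k] is [h] and [k] is [u ∘ h]. *)
Lemma comprehension_iso (C : ProdCategory) (P : PrimaryDoctrine C) (A : C)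
    (phi : P A) (X X' : C) (c : hom X A) (c' : hom X' A)
    (u : hom X X') (v : hom X' X) :
  is_comprehension phi c -> c' ∘ u = c -> c ∘ v = c' -> u ∘ v = idc X' ->
  is_comprehension phi c'.
Proof.
intros [hc uc] eu ev e; split.
- rewrite <- ev, reindex_comp, <- (isl_top (reindex P v)); apply isl_mono, hc.
- intros Y g hg; destruct (uc Y g hg) as [h [eh uh]].
  exists (u ∘ h); split.
  + rewrite comp_assoc, eu; exact eh.
  + intros k ek; rewrite (uh (v ∘ k)).
    * rewrite comp_assoc, e; apply comp_id_l.
    * rewrite comp_assoc, ev; exact ek.
Qed.

(** The domain of [c'] may carry any equivalence relation, so [c'] is compared with the lift of a
    comprehension [c] chosen in [P]. Both are terminal, and the comparison arrows are sent by the
    forgetful functor to [P]'s base category. *)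
Lemma descent_preserves_comprehensions (C : ProdCategory) (P : PrimaryDoctrine C) :
  has_comprehensions P -> preserves_comprehensions (descent_arrow P).
Proof.
intros hP A phi X' c' hc'.
destruct (hP (qcar A) (proj1_sig phi)) as [X [c hc]].
destruct (pullback_comprehension (phi := phi) hc) as [tc uc].
destruct hc' as [tc' uc'].
destruct (uc _ _ tc') as [v [ev _]]; destruct (uc' _ _ tc) as [u [eu _]].
(* Both sides factor [c'] through itself, and such a factorization is unique. *)
assert (e : u ∘ v = idc X').
{ destruct (uc' _ _ tc') as [w [_ uw]].
  rewrite <- (uw (u ∘ v)), (uw (idc X')); [reflexivity | apply comp_id_r |].
  rewrite comp_assoc, eu; exact ev. }
exact (comprehension_iso hc (f_equal (@qmap _ _ _ _) eu)
  (f_equal (@qmap _ _ _ _) ev) (f_equal (@qmap _ _ _ _) e)).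
Qed.

Lemma descent_comprehensions (C : ProdCategory) (P : PrimaryDoctrine C) :
  has_comprehensions P -> has_comprehensions (descent_doctrine P).
Proof.
intros hP A phi; destruct (hP (qcar A) (proj1_sig phi)) as [X [c hc]].
exists (pullback_obj c), (pullback_hom c); exact (pullback_comprehension hc).
Qed.

(** Preservation makes the underlying arrow a comprehension in [P], whose fullness applies in
    particular to elements that are descent data. *)
Lemma descent_full_comprehensions (C : ProdCategory) (P : PrimaryDoctrine C) :
  has_full_comprehensions P -> has_full_comprehensions (descent_doctrine P).
Proof.
intros [hP hf]; split; [exact (descent_comprehensions hP) |].
intros A phi X c hc b hb.
exact (hf _ _ _ _ (descent_preserves_comprehensions hP hc) _ hb).
Qed.

Theorem proposition4p1 (C : ProdCategory) (P : PrimaryDoctrine C) :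
  (has_finite_distributive_joins P ->
     has_finite_distributive_joins (descent_doctrine P) /\
     preserves_finite_joins (descent_arrow P)) /\
  (implicational P ->
     implicational (descent_doctrine P) /\
     preserves_rpc (descent_arrow P)) /\
  (existential P ->
     existential (descent_doctrine P) /\
     preserves_left_adjoints (descent_arrow P)) /\
  (universal P ->
     universal (descent_doctrine P) /\
     preserves_right_adjoints (descent_arrow P)) /\
  (has_comprehensions P ->
     has_comprehensions (descent_doctrine P) /\
     preserves_comprehensions (descent_arrow P)) /\
  (has_full_comprehensions P ->
     has_full_comprehensions (descent_doctrine P) /\
     preserves_comprehensions (descent_arrow P)).
Proof.
repeat match goal with |- _ /\ _ => split | |- _ -> _ => intros hP end.
- exact (descent_finite_distributive_joins hP).
- exact (descent_preserves_finite_joins hP).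
- exact (descent_implicational hP).
- exact (descent_preserves_rpc hP).
- exact (descent_existential hP).
- exact (descent_preserves_left_adjoints hP).
- exact (descent_universal hP).
- exact (descent_preserves_right_adjoints hP).
- exact (descent_comprehensions hP).
- exact (descent_preserves_comprehensions hP).
- exact (descent_full_comprehensions hP).
- exact (descent_preserves_comprehensions (proj1 hP)).
Qed.
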